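(* Fix a positive integer $r$. Let $\mathbf{P}_n$ ($n\ge1$) and $\mathbf{P}_\infty$ be probability measures on the space of locally finite rooted trees of height at most $r$, with expectations $\mathbf{E}_n$, $\mathbf{E}_\infty$, and let $\mathbf{T}$ denote the random tree. Suppose $\mathbf{E}_nN(\mathbf{T};t)\to\mathbf{E}_\infty N(\mathbf{T};t)<\infty$ for all finite rooted trees $t$ of height at most $r$, and that $\mathbf{P}_\infty$ is uniquely determined by the values of $\mathbf{E}_\infty N(\mathbf{T};t)$ (i.e. it is the only probability measure on such trees with these values). Then $\mathbf{P}_n$ converges in distribution to $\mathbf{P}_\infty$.
   Context: Rooted trees are identified up to rooted isomorphism. For finite rooted $t$ and rooted $u$, $N(u;t)$ is the number of tree-maps from $t$ to $u$, i.e. injective maps from the vertices of $t$ to the vertices of $u$ sending root to root and adjacent vertices to adjacent vertices. $\mathbf{P}_n$ converges in distribution to $\mathbf{P}_\infty$ if $\mathbf{P}_n(\mathbf{T}=t)\to\mathbf{P}_\infty(\mathbf{T}=t)$ for every rooted tree $t$ of height at most $r$. *)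

(* Defs.v *)
From HB Require Import structures.
From mathcomp Require Import all_boot all_order all_algebra.
From mathcomp Require Import generic_quotient finmap.
From mathcomp Require Import all_classical all_reals all_analysis.

Set Implicit Arguments.
Unset Strict Implicit.
Unset Printing Implicit Defensive.

Local Open Scope classical_set_scope.
Local Open Scope quotient_scope.

Definition connected_graph (V : Type) (e : rel V) : Prop :=
  forall x y : V, exists2 p : seq V, path e x p & last x p = y.

Definition acyclic_graph (V : Type) (e : rel V) : Prop :=
  forall c : seq {classic V}, (2 < size c)%N -> ~ @ucycle {classic V} e c.

(* The vertex type is a bare [Type], not a [choiceType]: classes of trees must
   themselves form a [choiceType], and a record containing a [choiceType]
   would live in too large a universe.  Where decidable equality or choice is
   needed on vertices we use the classical alias [{classic V}]. *)
Record rooted_tree : Type := RootedTree {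
  vertex : Type;
  adj : rel vertex;
  root : vertex;
  adj_sym : symmetric adj;
  adj_irr : irreflexive adj;
  adj_connected : connected_graph adj;
  adj_acyclic : acyclic_graph adj }.

Arguments adj {r} : rename.
Arguments root : clear implicits.

Definition finite_tree (t : rooted_tree) : Prop :=
  finite_set [set: vertex t].

Definition locally_finite (t : rooted_tree) : Prop :=
  forall x : vertex t, finite_set [set y | adj x y].

Definition height_at_most (r : nat) (t : rooted_tree) : Prop :=
  forall x : vertex t, exists p : seq (vertex t),
    [/\ path adj (root t) p, last (root t) p = x & (size p <= r)%N].

Definition rooted_iso (t u : rooted_tree) : Prop :=
  exists f : vertex t -> vertex u,
    [/\ bijective f, f (root t) = root u & forall x y, adj (f x) (f y) = adj x y].

Definition tree_map (t u : rooted_tree) (f : vertex t -> vertex u) : Prop :=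
  [/\ injective f, f (root t) = root u &
      forall x y, adj x y -> adj (f x) (f y)].

(* N(u; t).  [fset_set] is junk on infinite sets, but there are finitely many
   tree-maps when [t] is finite and [u] is locally finite; see
   [tree_maps_finite] for the trees considered here. *)
Definition num_tree_maps (u t : rooted_tree) : nat :=
  #|` fset_set [set f : {classic (vertex t -> vertex u)} | tree_map f] |.

Record lf_tree (r : nat) : Type := LFTree {
  lf_tree_val :> rooted_tree;
  lf_tree_lf : locally_finite lf_tree_val;
  lf_tree_height : height_at_most r lf_tree_val }.

HB.instance Definition _ (r : nat) := gen_eqMixin (lf_tree r).
HB.instance Definition _ (r : nat) := gen_choiceMixin (lf_tree r).

Lemma rooted_iso_refl t : rooted_iso t t.
Proof. by exists id; split=> //; exists id. Qed.

Lemma rooted_iso_sym t u : rooted_iso t u -> rooted_iso u t.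
Proof.
move=> [f [[g fK gK] fr fa]]; exists g; split; first by exists f.
- by rewrite -fr fK.
- by move=> x y; rewrite -fa !gK.
Qed.

Lemma rooted_iso_trans t u v :
  rooted_iso t u -> rooted_iso u v -> rooted_iso t v.
Proof.
move=> [f [bf fr fa]] [g [bg gr ga]]; exists (g \o f); split.
- exact: bij_comp.
- by rewrite /= fr.
- by move=> x y /=; rewrite ga fa.
Qed.

Definition lf_isob (r : nat) : rel (lf_tree r) :=
  fun t u => `[< rooted_iso t u >].

Section lf_iso.
Variable r : nat.

Lemma lf_isob_refl : reflexive (@lf_isob r).
Proof. by move=> t; apply/asboolP/rooted_iso_refl. Qed.

Lemma lf_isob_sym : symmetric (@lf_isob r).
Proof. by move=> t u; apply/asboolP/asboolP => /rooted_iso_sym. Qed.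

Lemma lf_isob_trans : transitive (@lf_isob r).
Proof.
move=> u t v /asboolP tu /asboolP uv.
by apply/asboolP; exact: rooted_iso_trans uv.
Qed.

Canonical lf_iso_equiv :=
  EquivRel (@lf_isob r) lf_isob_refl lf_isob_sym lf_isob_trans.

End lf_iso.

(* Locally finite rooted trees of height at most r, up to rooted isomorphism. *)
Definition tree_space (r : nat) : Type := {eq_quot (@lf_iso_equiv r)}.

HB.instance Definition _ (r : nat) := Choice.on (tree_space r).
HB.instance Definition _ (r : nat) :=
  Quotient.copy (tree_space r) {eq_quot (@lf_iso_equiv r)}.

Section single_vertex.

Let e : rel unit := fun _ _ => false.

Let e_connected : connected_graph e.
Proof. by move=> [] []; exists [::]. Qed.

Let e_acyclic : acyclic_graph e.
Proof. by move=> [|x [|y c]]//= _; rewrite /ucycle /= andbF. Qed.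

Definition single_vertex_tree : rooted_tree :=
  @RootedTree unit e tt (fun _ _ => erefl) (fun _ => erefl)
    e_connected e_acyclic.

Lemma single_vertex_lf : locally_finite single_vertex_tree.
Proof. by move=> x /=; apply: sub_finite_set (finite_set0 _) => y. Qed.

Lemma single_vertex_height r : height_at_most r single_vertex_tree.
Proof. by move=> []; exists [::]. Qed.

End single_vertex.

HB.instance Definition _ (r : nat) := isPointed.Build (tree_space r)
  (\pi_(tree_space r) (LFTree single_vertex_lf (@single_vertex_height r))).

(* A locally finite tree of bounded height is finite, so [tree_space r] is
   countable and its sigma-algebra is that of all subsets. *)
HB.instance Definition _ (r : nat) := @isMeasurable.Build
  default_measure_display (tree_space r) discrete_measurable discrete_measurable0
  discrete_measurableC discrete_measurableU.

Lemma lf_tree_finite (r : nat) (t : lf_tree r) : finite_tree t.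
Proof.
have ball n : finite_set [set x : vertex t | exists p,
    [/\ path adj (root t) p, last (root t) p = x & (size p <= n)%N]].
  elim: n => [|n IHn].
    apply: sub_finite_set (finite_set1 (root t)) => x [[|y p] [_ <- //]].
  apply: (@sub_finite_set _ _ ([set root t] `|`
      \bigcup_(x in [set x : vertex t | exists p,
        [/\ path adj (root t) p, last (root t) p = x & (size p <= n)%N]])
        [set y | adj x y])).
    move=> y [p [+ + +]]; case/lastP: p => [|p z].
      by move=> _ /= <- _; left.
    rewrite rcons_path last_rcons size_rcons => /andP[pp pz] <- pn.
    by right; exists (last (root t) p) => //; exists p.
  rewrite finite_setU; split; first exact: finite_set1.
  by apply: bigcup_finite => // x _; exact: lf_tree_lf.
by apply: sub_finite_set (ball r) => x _; exact: lf_tree_height.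
Qed.

Lemma tree_maps_finite (r : nat) (u : lf_tree r) (t : rooted_tree) :
  finite_tree t ->
  finite_set [set f : {classic (vertex t -> vertex u)} | tree_map f].
Proof.
move=> t_fin.
have /(finite_seqP (T := {classic vertex t}))[s sE] := t_fin.
have /(finite_seqP (T := {classic vertex u}))[s' s'E] := lf_tree_finite u.
have s_all (x : {classic vertex t}) : x \in s.
  by have : [set` s] x by rewrite -sE.
have s'_all (y : {classic vertex u}) : y \in s'.
  by have : [set` s'] y by rewrite -s'E.
pose F (g : {ffun 'I_(size s) -> 'I_(size s')}) : {classic (vertex t -> vertex u)} :=
  fun x => nth (root u : {classic _}) s'
    (g (Ordinal (etrans (index_mem (x : {classic _}) s) (s_all x)))).
apply: (@sub_finite_set _ _ (F @` setT)); last exact: finite_image.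
move=> f _.
exists [ffun i : 'I_(size s) => Ordinal (etrans
  (index_mem (f (nth (root t : {classic _}) s i) : {classic _}) s') (s'_all _))] => //.
by apply/funext => x; rewrite /F ffunE /= !nth_index.
Qed.

Lemma eq_num_tree_maps (r : nat) (u v : lf_tree r) (t : rooted_tree) :
  finite_tree t -> rooted_iso u v -> num_tree_maps u t = num_tree_maps v t.
Proof.
move=> t_fin [f [[g fK gK] fr fa]].
pose phi (h : {classic (vertex t -> vertex u)}) :
  {classic (vertex t -> vertex v)} := f \o h.
have -> : num_tree_maps v t = #|` fset_set (phi @`
    [set h : {classic (vertex t -> vertex u)} | tree_map h])|.
  congr (#|` fset_set _|); apply/seteqP; split=> [h [hi hr ha]|_ [h [hi hr ha] <-]].
    exists (g \o h); last by apply/funext => x; rewrite /phi /= gK.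
    split.
    - exact: inj_comp (can_inj gK) hi.
    - by rewrite /= hr -fr fK.
    - by move=> x y /ha; rewrite /= -fa !gK.
  split.
  - exact: inj_comp (can_inj fK) hi.
  - by rewrite /phi /= hr.
  - by move=> x y /ha; rewrite /phi /= fa.
rewrite fset_set_image; last exact: tree_maps_finite.
rewrite card_imfset//.
by move=> h k /funeqP hk; apply/funext => x; exact: (can_inj fK (hk x)).
Qed.

(* N(T; t) for the class T, evaluated on a representative; by [eq_num_tree_maps]
   the choice of representative is immaterial. *)
Definition tree_map_count (r : nat) (T : tree_space r) (t : rooted_tree) : nat :=
  num_tree_maps (repr T : lf_tree r) t.

(* The event {T = t}: the random class T is that of the tree t. *)
Definition tree_is (r : nat) (t : rooted_tree) : set (tree_space r) :=
  [set T : tree_space r | rooted_iso (repr T : lf_tree r) t].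

Local Open Scope ereal_scope.

Definition converges_in_distribution (R : realType) (r : nat)
    (P : nat -> probability (tree_space r) R)
    (Pinf : probability (tree_space r) R) : Prop :=
  forall t : rooted_tree, height_at_most r t ->
    (fun n => P n (@tree_is r t)) @ \oo --> Pinf (@tree_is r t).

(* Main.v *)
(* Convergence along every ultrafilter refining the Frechet filter is enough,
   and along an ultrafilter every sequence of probabilities has a limit.  The limit
   is countably additive, with the limit moments, provided that the mass of
   N(T; t) on large trees is uniformly small.  This follows from Markov's
   inequality, as N(T; t) |T| is dominated by a linear combination of finitely
   many N(T; s): a tree-map from t together with a vertex of T factors through
   the subtree S of T spanned by the paths from the root to the image and to the
   vertex, and the order of S is bounded in terms of t and r.  By uniqueness each
   ultrafilter limit is therefore P_oo. *)
From HB Require Import structures.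
Require Import Defs.
From mathcomp Require Import all_boot all_order all_algebra.
From mathcomp Require Import generic_quotient finmap.
From mathcomp Require Import all_classical all_reals all_analysis.
From mathcomp Require Import measurable_realfun.

Import Order.TTheory GRing.Theory Num.Theory.
Local Open Scope classical_set_scope.
Local Open Scope ring_scope.
Local Open Scope ereal_scope.
Local Open Scope quotient_scope.

(** * Limits of probability measures along an ultrafilter *)

(** The values lie in the compact segment [0, 1], so they have a cluster point along [U]; an
    ultrafilter converges to each of its cluster points. *)
Lemma ultra_probability_cvg d (T : measurableType d) (R : realType)
    (U : set_system nat) (P : nat -> probability T R) (A : set T) :
  UltraFilter U -> measurable A -> exists x : R, P n A @[n --> U] --> x%:E.
Proof.
move=> Uultra mA.
have PA_fin n : P n A \is a fin_num by exact: fin_num_measure.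
have [|x [_ xcl]] := @segment_compact R 0%R 1%R ((fun n => fine (P n A)) @ U).
  apply: (@filterE _ U) => n /=.
  by rewrite /= in_itv/= fine_ge0//= -lee_fin fineK ?probability_le1.
exists x; apply: cvg_EFin; first exact: filterE.
move=> W /= Wx.
have [//|UWc] := in_ultra_setVsetC ((fun n => fine (P n A)) @^-1` W) Uultra.
by have [y []] := xcl (~` W) W UWc Wx.
Qed.

(** If the preimage of a neighbourhood [W] of [l] were not in [F], then [F] and the complement of
    that preimage would generate a proper filter [G]. An ultrafilter above [G] refines [F] and
    contains the complement, but by assumption it also contains the preimage. *)
Lemma ultra_cvgP (T : Type) (X : topologicalType) (F : set_system T)
    (f : T -> X) (l : X) :
  ProperFilter F ->
  (forall U : set_system T, UltraFilter U -> F `<=` U -> f @ U --> l) ->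
  f @ F --> l.
Proof.
move=> FF fUl W Wl; apply: contrapT => nFW.
pose G : set_system T := [set B | exists2 A, F A & A `&` ~` (f @^-1` W) `<=` B].
have GF : ProperFilter G.
  apply: Build_ProperFilter_ex.
    move=> B [A FA AB]; apply: contrapT => B0; apply: nFW.
    apply: (@filterS _ F _ A _ _ FA) => x Ax; apply: contrapT => Wx; apply: B0.
    by exists x; apply: AB.
  split.
  - by exists setT; [exact: filterT|].
  - move=> B C [A FA AB] [A' FA' AC]; exists (A `&` A'); first exact: filterI.
    by move=> x [[Ax A'x] Wx]; split; [apply: AB|apply: AC].
  - by move=> B C BC [A FA AB]; exists A => //; exact: subset_trans BC.
have [U [Uultra GU]] := ultraFilterLemma GF.
have FU : F `<=` U by move=> A FA; apply: GU; exists A => // x [].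
have UW : U (f @^-1` W) by exact: fUl Wl.
have UWc : U (~` (f @^-1` W)).
  by apply: GU; exists setT; [exact: filterT|move=> x []].
by have [x []] := filter_ex (filterI UW UWc).
Qed.


(** Monotonicity and finite additivity pass to setwise limits. Countable additivity comes from
    tightness: the part of a disjoint union missed by its first [n] terms eventually avoids the
    finite set [K], so its limit mass is at most [e]. *)
Lemma tight_ultra_probability_cvg d (T : measurableType d) (R : realType)
    (U : set_system nat) (P : nat -> probability T R) :
  UltraFilter U -> (forall A : set T, measurable A) ->
  (forall e : R, (0 < e)%R ->
    exists2 K : set T, finite_set K & \forall n \near U, P n (~` K) <= e%:E) ->
  exists Q : probability T R, forall A, P n A @[n --> U] --> Q A.
Proof.
move=> Uultra mT tight.
have /choice[q Pq] (A : set T) : exists x : R, P n A @[n --> U] --> x%:E.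
  exact: ultra_probability_cvg.
pose Q A := (q A)%:E.
have Qlim A l : P n A @[n --> U] --> l -> Q A = l.
  by move=> Pl; apply: cvg_unique Pl => //; exact: Pq.
have Q0 : Q set0 = 0.
  apply: Qlim.
  by under eq_fun do rewrite measure0; exact: cvg_cst.
have Q1 : Q setT = 1.
  apply: Qlim.
  by under eq_fun do rewrite probability_setT; exact: cvg_cst.
have Qge0 A : 0 <= Q A by apply: (cvge_to_ge (Pq A)); exact: filterE.
have Qle A B : A `<=` B -> Q A <= Q B.
  by move=> AB; apply: (lee_cvg_to (Pq A) (Pq B)); apply: filterE => n;
    rewrite le_measure// inE.
have QU A B : A `&` B = set0 -> Q (A `|` B) = Q A + Q B.
  move=> AB; apply: Qlim.
  under eq_fun do rewrite measureU//.
  by apply: cvgeD; [|exact: Pq|exact: Pq].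
have QsU A B : Q (A `|` B) <= Q A + Q B.
  rewrite -(setDUK (@subsetUl _ A B)) QU ?setDIK//; apply: leeD => //.
  by apply: Qle => x [[]].
have Qbig (F : nat -> set T) n : trivIset setT F ->
    \sum_(0 <= i < n) Q (F i) = Q (\big[setU/set0]_(i < n) F i).
  move=> tF; elim: n => [|n IHn]; first by rewrite big_nil big_ord0.
  rewrite big_nat_recr//= big_ord_recr/= QU ?IHn//.
  by apply: (@trivIset_bigsetUI _ xpredT F) => //; exact: sub_trivIset tF.
have Qsigma : semi_sigma_additive Q.
  move=> F _ tF _; under eq_fun do rewrite Qbig//.
  apply: cvg_EFin; first exact: filterE.
  apply/cvgrPdist_le => e e0.
  have [K /finite_seqP[s Ks] PK] := tight e e0.
  have QK : Q (~` K) <= e%:E by exact: cvge_to_le (Pq _) PK.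
  (* Each of the finitely many points of [K] that belong to the union is reached at some finite
     stage; induction on an enumeration of [K] finds a common stage. *)
  have : \forall n \near \oo,
      K `&` \bigcup_n F n `<=` \big[setU/set0]_(i < n) F i.
    rewrite Ks; elim: {Ks} s => [|x s IHs]; first by apply: filterE => n y [].
    have [[i _ Fix]|nFx] := pselect ((\bigcup_n F n) x); last first.
      apply: filterS IHs => n Kn y [].
      by rewrite /= inE => /orP[/eqP-> //|ys] Fy; exact: Kn.
    apply: filterS2 (nbhs_infty_gt i) IHs => n ltin Kn y [].
    rewrite /= inE => /orP[/eqP-> _|ys Fy]; last exact: Kn.
    exact: bigsetU_sup Fix.
  apply: filterS => n Kn.
  have QFn : Q (\big[setU/set0]_(i < n) F i) <= Q (\bigcup_n F n).
    apply: Qle; exact: bigsetU_bigcup.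
  have : Q (\bigcup_n F n) <= Q (\big[setU/set0]_(i < n) F i) + e%:E.
    apply: (@le_trans _ _ (Q (\big[setU/set0]_(i < n) F i `|` ~` K))).
      apply: Qle => x Fx; have [Kx|] := pselect (K x); last by right.
      by left; exact: Kn.
    by apply: le_trans (QsU _ _) _; exact: leeD.
  rewrite -EFinD lee_fin => h; rewrite ler_distlC.
  move: QFn; rewrite lee_fin => QFn; apply/andP; split.
    by rewrite lerBlDr.
  by rewrite (le_trans QFn)// lerDl ltW.
pose Qm : {measure set T -> \bar R} :=
  HB.pack Q (isMeasure.Build _ _ _ Q Q0 Qge0 Qsigma).
pose Qp : probability T R :=
  HB.pack Q (isMeasure.Build _ _ _ Q Q0 Qge0 Qsigma)
    (Measure_isProbability.Build _ _ _ Qm Q1).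
by exists Qp.
Qed.

(** * Passage of moments to the limit *)

Lemma integral_finite_set_cvg d (T : measurableType d) (R : realType)
    (U : set_system nat) (P : nat -> probability T R) (Q : probability T R)
    (K : set T) (f : T -> R) :
  ProperFilter U -> (forall A : set T, measurable A) ->
  (forall A, P n A @[n --> U] --> Q A) -> finite_set K ->
  (forall x, 0 <= f x)%R ->
  \int[P n]_(x in K) (f x)%:E @[n --> U] --> \int[Q]_(x in K) (f x)%:E.
Proof.
move=> UF mT PQ /finite_seqP[s ->] f0.
have integralE (mu : probability T R) : \int[mu]_(x in [set` s]) (f x)%:E =
    \sum_(x <- undup s) (f x)%:E * mu [set x].
  (* The enumeration may repeat points; [undup] makes the singletons pairwise disjoint, which turns
     the integral into a finite sum of point masses. *)
  have -> : [set` s] = \big[setU/set0]_(x <- undup s) [set x].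
    rewrite -bigcup_seq; apply/seteqP; split=> x /=.
      by rewrite -mem_undup => xs; exists x.
    by move=> [y ys ->]; rewrite -mem_undup.
  rewrite ge0_integral_bigsetU//.
  - apply: eq_bigr => x _; rewrite -integral_cst//.
    by apply: eq_integral => y /set_mem ->.
  - exact: undup_uniq.
  - by move=> x y _ _ [z [-> ->]].
  - by move=> x _; rewrite lee_fin.
under eq_fun do rewrite integralE.
rewrite integralE; apply: cvg_nnesum => x _.
  by apply: filterE => n; rewrite mule_ge0 ?lee_fin.
exact: cvgeZl.
Qed.

(** For the upper bound, each integral over [K k] has limit at most [m], and monotone convergence in
    [k] covers the whole space. For the lower bound, truncation to a suitable [K k] loses at most
    [e], uniformly in [n] near [U]. *)
Lemma integral_tight_lim d (T : measurableType d) (R : realType)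
    (U : set_system nat) (P : nat -> probability T R) (Q : probability T R)
    (K : nat -> set T) (f : T -> R) (m : \bar R) :
  ProperFilter U -> (forall A : set T, measurable A) ->
  (forall A, P n A @[n --> U] --> Q A) ->
  nondecreasing_seq K -> (forall k, finite_set (K k)) ->
  \bigcup_k K k = setT -> (forall x, 0 <= f x)%R ->
  (forall e : R, (0 < e)%R -> exists k,
     \forall n \near U, \int[P n]_(x in ~` K k) (f x)%:E <= e%:E) ->
  \int[P n]_x (f x)%:E @[n --> U] --> m -> \int[Q]_x (f x)%:E = m.
Proof.
move=> UF mT PQ ndK finK KT f0 tail Pm.
have mf (D : set T) (g : T -> \bar R) : measurable_fun D g.
  by move=> _ Y _; exact: mT.
have PK k := @integral_finite_set_cvg _ _ _ _ P Q _ f UF mT PQ (finK k) f0.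
apply/eqP; rewrite eq_le; apply/andP; split.
  rewrite -KT.
  apply: (cvge_to_le (ge0_nondecreasing_set_cvg_integral ndK _ _ _)) => //.
  - by move=> k x _; rewrite lee_fin.
  - apply: filterE => k. apply: (lee_cvg_to (PK k) Pm).
    apply: filterE => n; apply: ge0_subset_integral => // x _.
    by rewrite lee_fin.
apply/lee_addgt0Pr => e e0; have [k tailk] := tail e e0.
have : m <= \int[Q]_(x in K k) (f x)%:E + e%:E.
  apply: (lee_cvg_to Pm (cvgeD _ (PK k) (cvg_cst e%:E))).
  - exact: fin_num_adde_defl.
  - apply: filterS tailk => n le_e.
    rewrite -(setvU (K k)) setUC ge0_integral_setU//.
    + exact: leeD.
    + by move=> x _; rewrite lee_fin.
    + exact/disj_set2P/setICr.
move=> /le_trans; apply; apply: leeD => //.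
by apply: ge0_subset_integral => // x _; rewrite lee_fin.
Qed.

(** An abstract form of the argument: [h] is a size with finite sublevel sets, and the [F i] are the
    statistics whose moments are known. Domination of [F i * h] yields uniformly small tails for
    every [F i]; the constant statistic turns this into tightness of the measures themselves. *)
Lemma moment_method d (T : measurableType d) (R : realType) (I : Type)
    (h : T -> nat) (F : I -> T -> R) (P : nat -> probability T R)
    (Pinf : probability T R) :
  (forall A : set T, measurable A) ->
  (forall k, finite_set [set x | (h x <= k)%N]) ->
  (forall i x, 0 <= F i x)%R -> (exists i, forall x, F i x = 1%R) ->
  (forall i, exists (s : seq I) (c : I -> R), (forall j, 0 <= c j)%R /\
     forall x, (F i x * (h x)%:R <= \sum_(j <- s) c j * F j x)%R) ->
  (forall i, \int[P n]_x (F i x)%:E @[n --> \oo] --> \int[Pinf]_x (F i x)%:E) ->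
  (forall i, \int[Pinf]_x (F i x)%:E < +oo) ->
  (forall Q : probability T R,
     (forall i, \int[Q]_x (F i x)%:E = \int[Pinf]_x (F i x)%:E) ->
     forall A, Q A = Pinf A) ->
  forall A, P n A @[n --> \oo] --> Pinf A.
Proof.
move=> mT finh F0 [i1 Fi1] Fdom PF Pfin Puniq A.
have mf (D : set T) (g : T -> \bar R) : measurable_fun D g.
  by move=> _ Y _; exact: mT.
have bounded i : exists B : R, \forall n \near \oo,
    \int[P n]_x (F i x * (h x)%:R)%:E <= B%:E.
  have [s [c [c0 Fs]]] := Fdom i.
  have sumE (mu : probability T R) :
      \int[mu]_x (\sum_(j <- s) c j * F j x)%:E =
      \sum_(j <- s) (c j)%:E * \int[mu]_x (F j x)%:E.
    under eq_integral do rewrite -sumEFin.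
    rewrite ge0_integral_sum//; last first.
      by move=> j x _; rewrite lee_fin mulr_ge0.
    apply: eq_bigr => j _; under eq_integral do rewrite EFinM.
    by rewrite ge0_integralZl ?lee_fin// => x _; rewrite lee_fin.
  pose m := \sum_(j <- s) (c j)%:E * \int[Pinf]_x (F j x)%:E.
  have Pm : \int[P n]_x (\sum_(j <- s) c j * F j x)%:E @[n --> \oo] --> m.
    under eq_fun do rewrite sumE.
    apply: cvg_nnesum => j _; last exact: cvgeZl.
    apply: filterE => n; rewrite mule_ge0 ?lee_fin//.
    by apply: integral_ge0 => x _; rewrite lee_fin.
  have mfin : m \is a fin_num.
    apply: (big_ind (fun y => y \is a fin_num)) => // [y z yfin zfin|j _].
      by rewrite fin_numD yfin.
    rewrite fin_numM// ge0_fin_numE//.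
    by apply: integral_ge0 => x _; rewrite lee_fin.
  (* The moments of the dominating combination converge to the finite number [m], so they are
     eventually below [m + 1]. *)
  exists (fine m + 1)%R; rewrite EFinD fineK//.
  have m1 : nbhs m [set y | y < m + 1].
    apply: open_nbhs_nbhs; split; first exact: open_ereal_lt_ereal.
    by rewrite /= lteDl.
  have := Pm _ m1; apply: (@filterS _ \oo) => n /= ltm.
  apply: le_trans (ltW ltm).
  apply: ge0_le_integral => // x _; rewrite lee_fin //.
  - by rewrite mulr_ge0.
have tail i (e : R) : (0 < e)%R -> exists k, \forall n \near \oo,
    \int[P n]_(x in ~` [set x | (h x <= k)%N]) (F i x)%:E <= e%:E.
  move=> e0; have [B PB] := bounded i.
  (* Markov's inequality at threshold [k.+1]: off the sublevel set [h x >= k.+1], so [k.+1] times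
     the tail of [F i] is at most [B]. *)
  have [k kB] : exists k : nat, (B <= k.+1%:R * e)%R.
    by exists (Num.trunc (B / e)); rewrite -ler_pdivrMr// ltW// truncnS_gt.
  exists k; apply: filterS PB => n PB.
  rewrite -(@lee_pmul2l _ k.+1%:R%:E)// -EFinM.
  apply: le_trans (le_trans PB _); last by rewrite lee_fin.
  rewrite -ge0_integralZl//; last by move=> x _; rewrite lee_fin.
  apply: (@le_trans _ _
      (\int[P n]_(x in ~` [set x | (h x <= k)%N]) (F i x * (h x)%:R)%:E)).
    apply: ge0_le_integral => // x; first by rewrite mule_ge0 ?lee_fin.
    move=> /negP; rewrite -ltnNge => kx.
    by rewrite -EFinM lee_fin mulrC ler_wpM2l// ler_nat.
  by apply: ge0_subset_integral => // x _; rewrite lee_fin mulr_ge0.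
apply: ultra_cvgP => U Uultra ooU.
have tailU i (e : R) : (0 < e)%R -> exists k, \forall n \near U,
    \int[P n]_(x in ~` [set x | (h x <= k)%N]) (F i x)%:E <= e%:E.
  by move=> /(tail i)[k /ooU]; exists k.
(* For the constant statistic [F i1], the tail bound is exactly tightness. *)
have [e e0|Q PQ] := @tight_ultra_probability_cvg _ T R U P Uultra mT.
  have [k Pk] := tailU i1 e e0; exists [set x | (h x <= k)%N] => //.
  apply: filterS Pk => n; under eq_integral do rewrite Fi1.
  by rewrite integral_cst// mul1e.
(* It remains to see that the ultrafilter limit [Q] has the moments of [Pinf]. *)
rewrite -(Puniq Q) => [|i]; first exact: PQ.
apply: (@integral_tight_lim _ _ _ U P Q
  (fun k => [set x | (h x <= k)%N])) => //.
- by move=> k l kl; apply/subsetPset => x /= /leq_trans; apply.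
- by apply/seteqP; split=> // x _; exists (h x) => /=.
- exact: tailU.
- exact: (cvg_trans (cvg_app _ ooU)).
Qed.

(** * Subtrees spanned by paths from the root *)

(* Empty when [t] is infinite, since [fset_set] is junk there. *)
Definition vertices (t : rooted_tree) : seq {classic vertex t} :=
  fset_set [set: {classic vertex t}].

Definition tree_order (t : rooted_tree) : nat := size (vertices t).

Lemma mem_vertices (t : rooted_tree) (x : {classic vertex t}) :
  finite_tree t -> x \in vertices t.
Proof. by move=> tfin; rewrite /vertices in_fset_set// inE. Qed.

Lemma uniq_vertices (t : rooted_tree) : uniq (vertices t).
Proof. exact: fset_uniq. Qed.

Lemma path_sym_rev {V : Type} {e : rel V} {x : V} {p : seq V} :
  symmetric e -> path e x p ->
  exists2 q, path e (last x p) q & last (last x p) q = x.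
Proof.
move=> es; elim/last_ind: p => [|p y IHp]; first by exists [::].
rewrite rcons_path last_rcons => /andP[/IHp[q qp ql] py].
by exists (last x p :: q) => //=; rewrite es py.
Qed.

Lemma connected_from_root {V : Type} {e : rel V} (x0 : V) :
  symmetric e -> (forall x, exists2 p, path e x0 p & last x0 p = x) ->
  connected_graph e.
Proof.
move=> es e0 x y; have [p pp <-] := e0 x; have [q qp ql] := e0 y.
have [p' pp' pl'] := path_sym_rev es pp.
by exists (p' ++ q); rewrite ?cat_path ?last_cat ?pl' ?pp'.
Qed.

Section induced_subtree.
Variables (r : nat) (T : lf_tree r) (s : seq {classic vertex T}).
Hypothesis root_s : (Defs.root T : {classic vertex T}) \in s.
Hypothesis path_s : forall x : {classic vertex T}, x \in s ->
  exists p : seq {classic vertex T},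
    [/\ path adj (Defs.root T) p, last (Defs.root T) p = x, (size p <= r)%N &
        {subset p <= s}].

(* Not a subtype of [{classic vertex T}]: that type lives in too large a universe
   to be the vertex type of a [rooted_tree]. *)
Let V := {x : vertex T | (x : {classic vertex T}) \in s}.
Let e : rel V := fun x y => @adj T (val x) (val y).
Let v0 : V := exist _ (Defs.root T) root_s.

Let e_sym : symmetric e. Proof. by move=> x y; exact: adj_sym. Qed.
Let e_irr : irreflexive e. Proof. by move=> x; exact: adj_irr. Qed.

Let e_path (x : V) : exists p : seq V,
  [/\ path e v0 p, last v0 p = x & (size p <= r)%N].
Proof.
have lift (p : seq {classic vertex T}) (a : V) :
    path adj (val a) p -> {subset p <= s} ->
    exists q : seq V,
      [/\ path e a q, last (val a) p = val (last a q) & size q = size p].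
  elim: p a => [|y p IHp] a /=; first by exists [::].
  move=> /andP[ay yp] ps.
  have ys : y \in s by apply: ps; rewrite inE eqxx.
  have [|q [qp ql qs]] := IHp (exist _ y ys) yp.
    by move=> z zp; apply: ps; rewrite inE zp orbT.
  by exists (exist _ y ys :: q); split; rewrite /= ?qs// /e/= ay.
have [p [pp pl pr ps]] := path_s _ (valP x).
have [q [qp ql qs]] := lift p v0 pp ps.
exists q; split; rewrite ?qs//; apply: val_inj.
by rewrite -ql.
Qed.

Let e_connected : connected_graph e.
Proof.
apply: (connected_from_root v0) => // x.
by have [p [? ? _]] := e_path x; exists p.
Qed.

Let e_acyclic : acyclic_graph e.
Proof.
move=> c c2 /andP[cc cu].
apply: (@adj_acyclic T (map (fun x : {classic V} => val (x : V)) c)).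
  by rewrite size_map.
rewrite /ucycle map_inj_uniq ?cu ?andbT; last exact: val_inj.
by rewrite cycle_map.
Qed.

Let S0 := @RootedTree V e v0 e_sym e_irr e_connected e_acyclic.

Let S0_finite : finite_tree S0.
Proof.
change (finite_set [set: V]).
have -> : [set: V] = (@sval _ _ : V -> {classic vertex T}) @^-1` [set` s].
  by apply/seteqP; split=> // x _; exact: valP x.
apply: finite_preimage; last exact: finite_seq.
by move=> x y _ _; exact: val_inj.
Qed.

(** The subgraph on [s] is connected through the root because [path_s] keeps a short root path of
    each vertex inside [s], and acyclic because its cycles are cycles of [T]. The map [g] is the
    inclusion. As [s] may have repetitions, its size only bounds the order. *)
Lemma induced_subtree : exists S : lf_tree r,
  (tree_order S <= size s)%N /\
  exists g : vertex S -> vertex T, [/\ tree_map g,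
    forall x y, adj (g x) (g y) = adj x y &
    forall x : {classic vertex T}, x \in s -> exists y, g y = x].
Proof.
have S0_lf : locally_finite S0 by move=> x; exact: sub_finite_set S0_finite.
exists (@LFTree r S0 S0_lf e_path); split.
  rewrite /tree_order -(size_map (fun x : {classic V} => val (x : V))).
  apply: uniq_leq_size.
    rewrite map_inj_uniq; [exact: uniq_vertices|by move=> x y /val_inj].
  by move=> x /mapP[y _ ->]; exact: valP.
exists (fun x : V => val x); split; last 2 first.
- by [].
- by move=> x xs; exists (exist _ x xs).
by split => //; exact: val_inj.
Qed.

End induced_subtree.

(** Each vertex of [l] is joined to the root by a path of at most [r] steps, and the subtree is
    induced on all vertices met. A path list omits its starting vertex, so each path adds at most
    [r] entries, and the root adds one. *)
Lemma subtree_cover (r : nat) (T : lf_tree r) (l : seq {classic vertex T}) :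
  exists S : lf_tree r, (tree_order S <= (size l * r).+1)%N /\
  exists g : vertex S -> vertex T, [/\ tree_map g,
    forall x y, adj (g x) (g y) = adj x y &
    forall x : {classic vertex T}, x \in l -> exists y, g y = x].
Proof.
have /choice[p pP] (x : {classic vertex T}) : exists p : seq {classic vertex T},
    [/\ path adj (Defs.root T) p, last (Defs.root T) p = x & (size p <= r)%N].
  exact: lf_tree_height.
pose s : seq {classic vertex T} := Defs.root T :: flatten (map p l).
have ls x : x \in l -> x \in s.
  move=> xl; have [_ px _] := pP x.
  have := mem_last (Defs.root T : {classic vertex T}) (p x).
  rewrite px !inE => /orP[->//|xp]; apply/orP; right.
  by apply/flattenP; exists (p x) => //; exact: map_f.
have s_path (x : {classic vertex T}) : x \in s ->
  exists p : seq {classic vertex T},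
    [/\ path adj (Defs.root T) p, last (Defs.root T) p = x, (size p <= r)%N &
        {subset p <= s}].
  rewrite inE => /orP[/eqP->|]; first by exists [::].
  move=> /flattenP[_ /mapP[y yl ->] xp]; have [yp _ yr] := pP y.
  have sub : {subset p y <= s}.
    move=> z zp; rewrite inE; apply/orP; right; apply/flattenP.
    by exists (p y) => //; exact: map_f.
  (* A vertex inside a chosen path is reached by the initial segment of that path ending there. *)
  case/splitPr : xp yp yr sub => p1 p2.
  rewrite -cat_rcons cat_path size_cat => /andP[p1p _] p1r sub.
  exists (rcons p1 x); split=> //.
  - by rewrite last_rcons.
  - exact: leq_trans (leq_addr _ _) p1r.
  - by move=> z zp; apply: sub; rewrite mem_cat zp.
have [|S [Ss [g [gt ga gs]]]] := @induced_subtree r T s _ s_path.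
  by rewrite inE eqxx.
exists S; split.
  apply: leq_trans Ss _; rewrite /s /= ltnS size_flatten /shape -map_comp.
  elim: l {s ls s_path gs} => //= x l IHl.
  by rewrite mulSn leq_add//; have [] := pP x.
by exists g; split=> // x /ls; exact: gs.
Qed.

(** * Finiteness of the set of trees of bounded order *)

(** A class is encoded, relative to the vertex list of its representative, by the adjacency matrix,
    the position of the root and the order. Equal codes make the representatives isomorphic, hence
    the classes equal. *)
Lemma finite_small_trees (r k : nat) :
  finite_set [set T : tree_space r | (tree_order (repr T : lf_tree r) <= k)%N].
Proof.
pose code (T : tree_space r) :
    ({ffun 'I_k * 'I_k -> bool} * 'I_k.+1 * 'I_k.+1) :=
  let t : rooted_tree := (repr T : lf_tree r) in
  (* Positions beyond the order read the root by default; this is harmless, as the matrices are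
     compared only at positions of actual vertices. *)
  let v i := nth (Defs.root t : {classic vertex t}) (vertices t) i in
  ([ffun ij : 'I_k * 'I_k => adj (v ij.1) (v ij.2)],
   inord (index (Defs.root t : {classic vertex t}) (vertices t)),
   inord (tree_order t)).
have code_inj :
  {in [set T : tree_space r | (tree_order (repr T : lf_tree r) <= k)%N] &,
    injective code}.
  move=> T T' /set_mem/= Tk /set_mem/= T'k [] /ffunP adjE rootE sizeE.
  rewrite -(reprK T) -(reprK T'); apply/eqmodP/asboolP.
  have fin (X : tree_space r) (x : {classic vertex (repr X : lf_tree r)}) :
      x \in vertices (repr X : lf_tree r) by apply/mem_vertices/lf_tree_finite.
  have {}sizeE : size (vertices (repr T : lf_tree r)) =
      size (vertices (repr T' : lf_tree r)).
    by move/(congr1 val) : sizeE; rewrite /= !inordK.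
  have {}rootE : index (Defs.root (repr T : lf_tree r) : {classic _})
        (vertices (repr T : lf_tree r)) =
      index (Defs.root (repr T' : lf_tree r) : {classic _})
        (vertices (repr T' : lf_tree r)).
    move/(congr1 val) : rootE; rewrite /= !inordK// ltnS.
      exact: leq_trans (index_size _ _) T'k.
    exact: leq_trans (index_size _ _) Tk.
  (* The isomorphism matches vertices at the same position in the two lists. *)
  pose f (X Y : tree_space r) (x : {classic vertex (repr X : lf_tree r)}) :=
    nth (Defs.root (repr Y : lf_tree r) : {classic _})
      (vertices (repr Y : lf_tree r)) (index x (vertices (repr X : lf_tree r))).
  have fK X Y : size (vertices (repr X : lf_tree r)) =
      size (vertices (repr Y : lf_tree r)) -> cancel (f X Y) (f Y X).
    move=> XY x; rewrite /f index_uniq ?uniq_vertices//.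
      by rewrite nth_index ?fin.
    by rewrite -XY index_mem fin.
  exists (f T T'); split.
  - by exists (f T' T); exact: fK.
  - by rewrite /f rootE nth_index ?fin.
  - move=> x y.
    have xk : (index (x : {classic _}) (vertices (repr T : lf_tree r)) < k)%N.
      by apply: leq_trans Tk; rewrite index_mem fin.
    have yk : (index (y : {classic _}) (vertices (repr T : lf_tree r)) < k)%N.
      by apply: leq_trans Tk; rewrite index_mem fin.
    by have := adjE (Ordinal xk, Ordinal yk); rewrite !ffunE/= !nth_index ?fin.
have /card_eqPle[_] := inj_card_eq code_inj.
move/card_le_finite; apply.
exact: finite_finset.
Qed.

(** * Domination of N(T; t) |T| by finitely many tree-map counts *)

Definition tree_maps (u t : rooted_tree) :
    seq {classic (vertex t -> vertex u)} :=
  fset_set [set f : {classic (vertex t -> vertex u)} | tree_map f].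

Lemma mem_tree_maps (r : nat) (u : lf_tree r) (t : rooted_tree)
    (f : {classic (vertex t -> vertex u)}) :
  finite_tree t -> (f \in tree_maps u t) = `[< tree_map f >].
Proof.
move=> tfin; rewrite /tree_maps in_fset_set; last exact: tree_maps_finite.
by apply/idP/asboolP; rewrite inE.
Qed.

(** The subtree is spanned by [x] and the image of [f], which is a list of [(tree_order t).+1]
    entries. Since its inclusion into [T] is injective and reflects adjacency, [f] lifts through it
    to a tree-map. *)
Lemma tree_map_factor (r : nat) (T : tree_space r) (t : lf_tree r)
    (f : vertex t -> vertex (repr T : lf_tree r))
    (x : vertex (repr T : lf_tree r)) :
  tree_map f -> exists S : tree_space r,
  (tree_order (repr S : lf_tree r) <= ((tree_order t).+1 * r).+1)%N /\
  exists (g : vertex (repr S : lf_tree r) -> vertex (repr T : lf_tree r))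
    (f' : vertex t -> vertex (repr S : lf_tree r))
    (y : vertex (repr S : lf_tree r)),
    [/\ tree_map g, tree_map f', f = g \o f' & x = g y].
Proof.
move=> [f_inj f_root f_adj].
pose l : seq {classic vertex (repr T : lf_tree r)} :=
  x :: [seq f z | z : {classic vertex t} <- vertices t].
have [S [S_le [g0 [[g0_inj g0_root g0_adj] g0_refl g0_surj]]]] :=
  subtree_cover r _ l.
(* The subtree [S] need not be the representative of its class; the isomorphism [i] from that
   representative to [S] transports the inclusion. *)
have : \pi_(tree_space r) (repr (\pi_(tree_space r) S)) = \pi_(tree_space r) S.
  exact: reprK.
move=> /eqmodP/asboolP [i [i_bij i_root i_adj]].
set S' := \pi_(tree_space r) S in i i_bij i_root i_adj.
pose g := g0 \o i; have [j iK jK] := i_bij.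
have g_adj y z : adj (g y) (g z) = adj y z by rewrite /g/= g0_refl i_adj.
have g_inj : injective g by apply: inj_comp => //; exact: can_inj iK.
have g_root :
    g (Defs.root (repr S' : lf_tree r)) = Defs.root (repr T : lf_tree r).
  by rewrite /g /= i_root.
have g_surj (z : {classic vertex (repr T : lf_tree r)}) :
    z \in l -> exists y, g y = z.
  by move=> /g0_surj[y <-]; exists (j y); rewrite /g/= jK.
have /choice[f' f'P] (z : vertex t) : exists y, g y = f z.
  apply: g_surj; rewrite inE; apply/orP; right; apply/mapP; exists z => //.
  exact/mem_vertices/lf_tree_finite.
have [y gy] : exists y, g y = x by apply: g_surj; rewrite inE eqxx.
exists S'; split.
  apply: leq_trans (leq_trans S_le _).
    rewrite /tree_order -(size_map (i : {classic _} -> {classic _})).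
    apply: uniq_leq_size.
      by rewrite map_inj_uniq; [exact: uniq_vertices|exact: can_inj iK].
    by move=> z _; exact/mem_vertices/lf_tree_finite.
  by rewrite /l/= size_map.
exists g, f', y; split=> //.
- by split => // a b; rewrite g_adj.
- split.
  + by move=> a b ab; apply: f_inj; rewrite -!f'P ab.
  + by apply: g_inj; rewrite f'P f_root g_root.
  + by move=> a b /f_adj; rewrite -!f'P g_adj.
- by apply/funext => z; rewrite /= f'P.
Qed.

(** The left side counts pairs of a tree-map from [t] to [T] and a vertex of [T]. Each is the
    composite of such a pair for a small tree [v] with a tree-map from [v] to [T]; the coefficient
    of [v] is its number of pairs. *)
Lemma tree_map_count_order (r : nat) (t : lf_tree r) :
  exists (s : seq (lf_tree r)) (c : lf_tree r -> nat),
  forall T : tree_space r,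
    (tree_map_count T t * tree_order (repr T : lf_tree r) <=
     \sum_(v <- s) c v * tree_map_count T v)%N.
Proof.
have /finite_seqP[s sE] := finite_small_trees r ((tree_order t).+1 * r).+1.
exists (map (fun v => repr v : lf_tree r) s),
  (fun v => (num_tree_maps v t * tree_order v)%N) => T.
set u : lf_tree r := repr T.
pose pairs (v : lf_tree r) :
    seq ({classic vertex t -> vertex v} * {classic vertex v}) :=
  [seq (f, x) | f <- tree_maps v t, x <- vertices v].
have size_pairs v : size (pairs v) = (num_tree_maps v t * tree_order v)%N.
  by rewrite size_allpairs.
pose lift (v : lf_tree r)
    (p : {classic vertex t -> vertex v} * {classic vertex v})
    (g : {classic vertex v -> vertex u}) :
    {classic vertex t -> vertex u} * {classic vertex u} := (g \o p.1, g p.2).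
pose lifts (v : lf_tree r) :=
  [seq lift v p g | p <- pairs v, g <- tree_maps u v].
have -> : (tree_map_count T t * tree_order u)%N = size (pairs u).
  by rewrite size_pairs.
have -> : (\sum_(v <- [seq (repr v : lf_tree r) | v <- s])
    num_tree_maps v t * tree_order v * tree_map_count T v)%N =
  size (flatten [seq lifts (repr v) | v <- s]).
  rewrite size_flatten /shape -map_comp sumnE !big_map.
  by apply: eq_bigr => v _; rewrite /= size_allpairs size_pairs.
(* The pairs for [T] are distinct, while the list of composites may repeat, so inclusion of the
   first list in the second suffices. *)
apply: uniq_leq_size.
  by apply: allpairs_uniq => [||[? ?] [? ?]//]; exact: fset_uniq.
move=> _ /allpairsP[[f x] /= [fm _ ->]].
move: fm; rewrite mem_tree_maps; last exact: lf_tree_finite.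
move=> /asboolP/(@tree_map_factor r T t f x).
move=> [v [vr [g [f' [y [gm f'm fE xE]]]]]].
apply/flattenP; exists (lifts (repr v)).
  apply: map_f; have : [set` s] v by rewrite -sE.
  by [].
rewrite fE xE; apply/allpairsP; exists ((f', y), g); split => //=.
  apply/allpairsP; exists (f', y); split => //=.
    by rewrite mem_tree_maps; [exact/asboolP|exact: lf_tree_finite].
  exact/mem_vertices/lf_tree_finite.
by rewrite mem_tree_maps; [exact/asboolP|exact: lf_tree_finite].
Qed.

(** * Application of the moment method to tree-map counts *)

(** The image of the root is forced. This provides the constant statistic required by
    [moment_method]. *)
Lemma num_tree_maps_single_vertex (u : rooted_tree) :
  num_tree_maps u single_vertex_tree = 1%N.
Proof.
rewrite /num_tree_maps.
have -> :
  [set f : {classic (vertex single_vertex_tree -> vertex u)} | tree_map f] =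
  [set ((fun=> Defs.root u) :
    {classic (vertex single_vertex_tree -> vertex u)})].
  apply/seteqP; split=> [f [_ f_root _]|_ ->] /=.
    by apply/funext => -[]; exact: f_root.
  by split=> // -[] [].
by rewrite fset_set1 cardfs1.
Qed.

Theorem proposition8p7 (R : realType) (r : nat) (r_gt0 : (0 < r)%N)
    (P : nat -> probability (tree_space r) R)
    (Pinf : probability (tree_space r) R)
    (cvg_moments : forall t : rooted_tree, finite_tree t -> height_at_most r t ->
      (fun n => 'E_(P n)[fun T => (tree_map_count T t)%:R]) @ \oo
        --> 'E_Pinf[fun T => (tree_map_count T t)%:R])
    (fin_moments : forall t : rooted_tree, finite_tree t -> height_at_most r t ->
      'E_Pinf[fun T => (tree_map_count T t)%:R] < +oo)
    (unique : forall Q : probability (tree_space r) R,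
      (forall t : rooted_tree, finite_tree t -> height_at_most r t ->
        'E_Q[fun T => (tree_map_count T t)%:R]
          = 'E_Pinf[fun T => (tree_map_count T t)%:R]) ->
      forall A : set (tree_space r), measurable A -> Q A = Pinf A) :
  converges_in_distribution P Pinf.
Proof.
move=> t _.
have E_integral (Q : probability (tree_space r) R) (S : rooted_tree) :
    'E_Q[fun T => (tree_map_count T S)%:R] =
    \int[Q]_T ((tree_map_count T S)%:R)%:E by rewrite unlock.
apply: (@moment_method _ (tree_space r) R (lf_tree r)
  (fun T : tree_space r => tree_order (repr T : lf_tree r))
  (fun S (T : tree_space r) => (tree_map_count T S)%:R)%R P Pinf).
- by [].
- exact: finite_small_trees.
- by move=> S T; rewrite ler0n.
- exists (LFTree single_vertex_lf (@single_vertex_height r)) => T.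
  by rewrite /tree_map_count num_tree_maps_single_vertex.
- move=> S; have [s [c Sc]] := tree_map_count_order r S.
  exists s, (fun S' => (c S')%:R)%R; split=> [S'|T]; first exact: ler0n.
  rewrite -natrM; under eq_bigr do rewrite -natrM.
  by rewrite -natr_sum ler_nat.
- move=> S; rewrite -E_integral; under eq_fun do rewrite -E_integral.
  by apply: cvg_moments; [exact: lf_tree_finite|exact: lf_tree_height].
- move=> S; rewrite -E_integral.
  by apply: fin_moments; [exact: lf_tree_finite|exact: lf_tree_height].
(* The statistics are indexed by [lf_tree r], whereas uniqueness speaks of finite trees of height at
   most [r]; such a tree is locally finite, so it is itself an index. *)
- move=> Q QP A; apply: unique => // S S_fin S_height.
  have S_lf : locally_finite S by move=> x; exact: sub_finite_set S_fin.
  by rewrite !E_integral; exact: (QP (LFTree S_lf S_height)).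
Qed.
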